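(* Let $X$ be a normed linear space of non-trivial cotype with $\operatorname{dens}X\ge\omega_\alpha$, where $\alpha$ is a limit ordinal. Then $\operatorname{rpc}X\ge\operatorname{rpc}B_X\ge\omega_\alpha$, where $B_X$ is the closed unit ball of $X$ with the metric inherited from $X$. Consequently, if $\operatorname{dens}X=\omega_\alpha$, then $\operatorname{rpc}X=\operatorname{rpc}B_X=\omega_\alpha$.
   Context: Non-trivial cotype means Rademacher cotype $q$ for some $2\le q<\infty$. $\operatorname{dens}X$ is the density character of $X$ (the least cardinality of a dense subset). Limit ordinals are non-zero. Let $M$ be a metric space; $U(x,r)$ denotes the open ball with centre $x$ and radius $r$. A covering of $M$ is a collection $\mathcal U$ of subsets of $M$ with $\bigcup\mathcal U=M$. A covering $\mathcal V$ is a refinement of a covering $\mathcal U$ if for every $V\in\mathcal V$ there is $U\in\mathcal U$ with $V\subset U$. A covering $\mathcal U$ of $M$ is uniform if there is $r>0$ such that the covering $\{U(x,r): x\in M\}$ is a refinement of $\mathcal U$. For a collection $\mathcal E$ of subsets of a set, its order $\operatorname{ord}\mathcal E$ is defined as follows: $\operatorname{ord}\mathcal E=n$ if $n=\max\{\operatorname{card}\mathcal D:\mathcal D\subset\mathcal E,\ \bigcap\mathcal D\ne\emptyset\}$ exists and is a natural number; otherwise $\operatorname{ord}\mathcal E$ is the infinite cardinal $\sup\{(\operatorname{card}\mathcal D)^+:\mathcal D\subset\mathcal E,\ \bigcap\mathcal D\neq\emptyset\}$, where $\kappa^+$ denotes the successor cardinal of $\kappa$. The reduced point character $\operatorname{rpc}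 M$ is the least cardinal $\alpha$ such that every uniform covering of $M$ has a uniform refinement $\mathcal V$ with $\operatorname{ord}\mathcal V\le\alpha$. *)

(* Defs.v *)
From mathcomp Require Import all_boot all_order all_algebra.
From mathcomp Require Import all_classical all_reals all_analysis.
Set Implicit Arguments.
Unset Strict Implicit.
Unset Printing Implicit Defensive.
Import Order.TTheory GRing.Theory Num.Theory.
Import numFieldNormedType.Exports.
Local Open Scope classical_set_scope.
Local Open Scope card_scope.
Local Open Scope ring_scope.

(** Cardinals are represented by types: two types denote the same cardinal when
    they are equipotent.  [cardinal] is one fixed universe; it also contains the
    carriers of the ordinals and the subsets of the spaces considered below, so
    that all the least cardinals taken below do exist. *)

Definition cardinal := Type.

Definition cle (K L : cardinal) : Prop := [set: K] #<= [set: L].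
Definition ceq (K L : cardinal) : Prop := [set: K] #= [set: L].
Definition clt (K L : cardinal) : Prop := cle K L /\ ~ cle L K.

Declare Scope cardinal_scope.
Delimit Scope cardinal_scope with C.
Notation "K <=c L" := (cle K L) (at level 70) : cardinal_scope.
Notation "K <c L" := (clt K L) (at level 70) : cardinal_scope.
Notation "K =c L" := (ceq K L) (at level 70) : cardinal_scope.
Open Scope cardinal_scope.

Definition is_least (P : cardinal -> Prop) (K : cardinal) : Prop :=
  P K /\ forall L, P L -> K <=c L.

(** The least cardinal satisfying [P], unique up to [=c]; the default value is
    only taken when no cardinal satisfies [P]. *)
Definition least (P : cardinal -> Prop) : cardinal :=
  match pselect (exists K, is_least P K) with
  | left h => projT1 (cid h)
  | right _ => void
  end.

Definition csucc (K : cardinal) : cardinal := least (fun L => K <c L).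

Definition csup (P : cardinal -> Prop) : cardinal :=
  least (fun L => forall K, P K -> K <=c L).

(** An ordinal is represented by a well-ordered type of that order type. *)
Record ordinal_number := OrdinalNumber {
  ocarrier :> Type;
  olt : ocarrier -> ocarrier -> Prop;
  olt_wf : well_founded olt;
  olt_trans : forall a b c, olt a b -> olt b c -> olt a c;
  olt_total : forall a b, olt a b \/ a = b \/ olt b a
}.

Definition limit_ordinal (alpha : ordinal_number) : Prop :=
  inhabited alpha /\ forall a : alpha, exists b : alpha, olt a b.

Definition next_infinite (I : cardinal) (f : I -> cardinal) : cardinal :=
  least (fun K => infinite_set [set: K] /\ forall i, f i <c K).

(** [omega_] is defined by the recursion
    omega_alpha = the least infinite cardinal > omega_beta for all beta < alpha;
    [omega_below a], for [a : alpha], is omega_beta where beta is the order type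
    of the initial segment of [alpha] below [a]. *)
Definition omega_below (alpha : ordinal_number) : alpha -> cardinal :=
  Fix (@olt_wf alpha) (fun _ => cardinal)
    (fun a rec => next_infinite
       (fun b : {b : alpha | olt b a} => rec (proj1_sig b) (proj2_sig b))).

Definition omega_ (alpha : ordinal_number) : cardinal :=
  next_infinite (@omega_below alpha).

Definition dens (T : topologicalType) : cardinal :=
  least (fun K => exists D : set T, dense D /\ K =c D).

(** [order_is_nat E n]: [n] is the largest cardinality of a subcollection of [E]
    with a common point ([\bigcap] of the empty subcollection is [setT]). *)
Definition order_is_nat (T : Type) (E : set (set T)) (n : nat) : Prop :=
  (exists D : set (set T),
     [/\ D `<=` E, \bigcap_(A in D) A !=set0 & D =c 'I_n]) /\
  (forall D : set (set T),
     D `<=` E -> \bigcap_(A in D) A !=set0 -> D <=c 'I_n).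

Definition coll_order (T : Type) (E : set (set T)) : cardinal :=
  match pselect (exists n, order_is_nat E n) with
  | left h => 'I_(projT1 (cid h))
  | right _ => csup (fun K => exists D : set (set T),
      [/\ D `<=` E, \bigcap_(A in D) A !=set0 & K =c csucc D])
  end.

(** Metric spaces are given as subsets [M] of an ambient space [T], with the
    inherited metric; thus the open ball of [M] is [ball x r `&` M]. *)

Definition covering (T : Type) (M : set T) (U : set (set T)) : Prop :=
  \bigcup_(A in U) A = M.

Definition refines (T : Type) (V U : set (set T)) : Prop :=
  forall A, V A -> exists2 B, U B & A `<=` B.

Definition uniform_covering (R : realType) (T : pseudoMetricType R)
    (M : set T) (U : set (set T)) : Prop :=
  covering M U /\
  exists2 r : R, 0 < r & refines [set ball x r `&` M | x in M] U.

Definition rpc (R : realType) (T : pseudoMetricType R) (M : set T) : cardinal :=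
  least (fun K => forall U, uniform_covering M U ->
    exists V, [/\ uniform_covering M V, refines V U & coll_order V <=c K]).

(** Rademacher cotype [q], with the [q]-th moment of the Rademacher sum: the
    average is over all choices of signs. *)
Definition has_cotype (R : realType) (X : normedModType R) (q : R) : Prop :=
  exists2 C : R, 0 < C & forall (n : nat) (x : 'I_n -> X),
    (\sum_(i < n) `|x i| `^ q) `^ q^-1 <=
    C * ((\sum_(e : {ffun 'I_n -> bool})
            `|\sum_(i < n) (-1) ^+ e i *: x i| `^ q) / 2 ^+ n) `^ q^-1.

Definition nontrivial_cotype (R : realType) (X : normedModType R) : Prop :=
  exists2 q : R, 2 <= q & has_cotype X q.

Definition unit_ball (R : realType) (X : normedModType R) : set X :=
  [set x | `|x| <= 1].
Arguments unit_ball {R} X.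

(* Main.v *)
(** For the lower bound, suppose that rpc B_X < omega_alpha. As alpha is a limit,
    there are infinite cardinals rpc B_X <= L_0 < L_1 < ... < omega_alpha.
    Coverings of B_X by small sets, each point lying in at most L_0 of them, can be
    rescaled and composed (L_0 * L_0 = L_0), so that every ball of X, however large,
    has a covering by sets of diameter at most 2 with multiplicity at most L_0 and a
    Lebesgue number 4 delta that does not depend on the ball. A 1/2-separated set
    that is maximal in B_X has more than L_n points for all n, since its span is
    dense. Multiplying it by 2 delta gives families (u^i_g), g in L_i, of small
    delta-separated vectors, and each sum u^1_(g_1) + ... + u^n_(g_n) is coloured by
    a member of the covering which contains its 4 delta-ball. If only one g_i varies,
    all these members contain the sum of the other terms, so there are at most L_0
    colours. As L_i > L_(i-1) at each level, by the pigeonhole principle some box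
    {g_1, g'_1} x ... x {g_n, g'_n} is monochromatic, so that all sign combinations
    of the n differences u^i_(g_i) - u^i_(g'_i) have norm at most 2, although each
    difference has norm at least delta. For large n this contradicts cotype q.

    The upper bound rpc X <= dens X comes from well-ordering a dense set (x_i) in its
    initial order type and taking the sets B(x_i, 3s) minus the union of the
    B(x_j, s), j < i. *)
Require Import Defs.
From mathcomp Require Import all_boot all_order all_algebra.
From mathcomp Require Import all_classical all_reals all_analysis wochoice.
From mathcomp Require Import lra.
From Stdlib Require Import Wellfounded Relation_Operators.
Set Implicit Arguments.
Unset Strict Implicit.
Unset Printing Implicit Defensive.
Import Order.TTheory GRing.Theory Num.Theory.
Import numFieldNormedType.Exports.
Local Open Scope classical_set_scope.
Local Open Scope ring_scope.

(** * Cardinal arithmetic *)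

Definition inset (T : Type) (A : set T) (x : T) (h : A x) : A :=
  SigSub (mem_set h).

Lemma cleP (K L : cardinal) : K <=c L <-> exists f : K -> L, injective f.
Proof.
rewrite /cle; split.
  case/card_leP/injfunPex => f _ fI.
  exists (fun x => val (f (SigSub (mem_set (I : setT x))))) => x y /val_inj h.
  by have /(congr1 val) := fI _ _ (in_setT _) (in_setT _) h.
move=> [f fI]; apply/card_leP/injfunPex.
exists (fun x => SigSub (mem_set (I : setT (f (val x))))) => // x y _ _.
by move=> /(congr1 val)/= /fI/val_inj.
Qed.

Lemma cle_refl (K : cardinal) : K <=c K.
Proof. exact: card_lexx. Qed.

Lemma cle_trans (K L M : cardinal) : K <=c L -> L <=c M -> K <=c M.
Proof. exact: card_le_trans. Qed.

Lemma ceqP (K L : cardinal) : K =c L <-> K <=c L /\ L <=c K.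
Proof.
rewrite /ceq /cle card_eq_le; split; first by move/andP.
by move=> [-> ->].
Qed.

Lemma cle_finite (K L : cardinal) :
  K <=c L -> finite_set [set: L] -> finite_set [set: K].
Proof. exact: card_le_finite. Qed.

Lemma cle_setT (T : Type) (A : set T) : A <=c T.
Proof. by apply/cleP; exists val; exact: val_inj. Qed.

Lemma cle_surj (K L : cardinal) (f : K -> L) :
  (forall y, exists x, f x = y) -> L <=c K.
Proof.
move=> fs; apply/cleP; exists (fun y => projT1 (cid (fs y))) => x y xy.
by rewrite -(projT2 (cid (fs x))) -(projT2 (cid (fs y))) xy.
Qed.

(** * Well-orders and the comparison of cardinals *)

Lemma exists_well_order (T : Type) : exists lt : T -> T -> Prop,
  [/\ well_founded lt, (forall a b c, lt a b -> lt b c -> lt a c) &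
      forall a b, lt a b \/ a = b \/ lt b a].
Proof.
elim/Peq: T => T.
have [r wr] := well_ordering_principle T.
have ranti x y : r x y -> r y x -> x = y.
  have wr' : {in <= predT, well_order r} by move=> A _; exact: wr.
  by move=> xy yx; apply: (wo_chain_antisymmetric wr') => //; rewrite xy.
have minE (A : set T) : A !=set0 -> exists2 z, A z & forall y, A y -> r z y.
  move=> [x Ax]; have [|z [[zA zm] _]] := wr (fun x => x \in A).
    by exists x; apply/mem_set.
  by exists z => [|y Ay]; [exact: set_mem zA | exact: zm (mem_set Ay)].
have rtot x y : r x y \/ r y x.
  have [|z [->|->] zm] := minE [set x; y]; first by exists x; left.
    by left; apply: zm; right.
  by right; apply: zm; left.
have rtr x y z : r x y -> r y z -> r x z.
  move=> xy yz; have [|t [[->|->]|->] tm] := minE [set x; y; z].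
  - by exists x; left; left.
  - by apply: tm; right.
  - by rewrite (ranti x y) // tm //; left; left.
  - by rewrite (ranti z y) // tm //; left; right.
exists (fun x y => r x y /\ x <> y); split.
- move=> x; apply: contrapT => nx.
  have [|z nz zm] := minE [set x | ~ Acc (fun x y => r x y /\ x <> y) x].
    by exists x.
  apply: nz; apply: Acc_intro => y [yz yNz]; apply: contrapT => ny.
  by apply: yNz; apply: ranti => //; exact: zm.
- move=> a b c [ab aNb] [bc bNc]; split; first exact: rtr bc.
  by move=> ac; apply: aNb; rewrite -ac in bc; exact: ranti.
- move=> a b; have [->|ab] := pselect (a = b); first by right; left.
  have [h|h] := rtot a b; first by left.
  by right; right; split=> // e; apply: ab.
Qed.

(** Transfinite recursion sends each [a] to a value not taken by its predecessors; one exists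
    because the initial segment below [a] cannot be mapped onto [T]. *)
Lemma well_order_embed (W T : Type) (lt : W -> W -> Prop) :
  well_founded lt -> (forall a b, lt a b \/ a = b \/ lt b a) ->
  (forall a, ~ T <=c [set x | lt x a]) -> W <=c T.
Proof.
move=> wf tot small.
pose next a (rec : forall x, lt x a -> T) (y : T) :=
  forall x (h : lt x a), rec x h <> y.
have nextE a (rec : forall x, lt x a -> T) : exists y, next a rec y.
  apply: contrapT => H; apply: (small a).
  apply: (@cle_surj [set x | lt x a] T
    (fun x => rec (val x) (set_mem (valP x)))) => y.
  apply: contrapT => hy; apply: H; exists y => x h e; apply: hy.
  exists (@inset _ [set x | lt x a] x h) => /=.
  by rewrite -e; congr (rec _ _); exact: Prop_irrelevance.
pose f := Fix wf (fun _ => T) (fun a rec => projT1 (cid (nextE a rec))).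
have fE a : f a = projT1 (cid (nextE a (fun x _ => f x))).
  rewrite {1}/f Fix_eq // => x g h gh.
  by have -> : g = h by apply: functional_extensionality_dep => y;
    apply: functional_extensionality_dep.
have fN a x : lt x a -> f x <> f a.
  by move=> xa; rewrite (fE a); case: (cid _) => /= y; apply.
apply/cleP; exists f => a b ab.
case: (tot a b) => [h|[//|h]]; first by case: (fN _ _ h).
by case: (fN _ _ h).
Qed.

Lemma cle_total (K L : cardinal) : K <=c L \/ L <=c K.
Proof.
have [lt [wf _ tot]] := exists_well_order K.
have [[a h]|h] := pselect (exists a, L <=c [set x | lt x a]).
  by right; apply: cle_trans h _; exact: cle_setT.
by left; apply: (well_order_embed wf tot) => a ha; apply: h; exists a.
Qed.

Lemma cltNge (K L : cardinal) : ~ L <=c K -> K <c L.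
Proof. by move=> h; split=> //; case: (cle_total K L). Qed.

Lemma exists_least (P : cardinal -> Prop) :
  (exists K, P K) -> exists K, is_least P K.
Proof.
move=> [K PK]; have [lt [wf tr tot]] := exists_well_order K.
pose Q a := exists2 L, P L & L <=c [set x | lt x a].
have [[a Qa]|nQ] := pselect (exists a, Q a); last first.
  exists K; split=> // L PL; apply: (well_order_embed wf tot) => a ha.
  by apply: nQ; exists a, L.
elim/(well_founded_ind wf) : a Qa => a IH Qa.
have [[b [ba Qb]]|nQ] := pselect (exists b, lt b a /\ Q b); first exact: IH Qb.
(* Here [a] is minimal with [Q a], so no member of [P] fits into an earlier segment; the segment
   below [a], and hence [L], embeds into every member of [P]. *)
have [L PL La] := Qa; exists L; split=> // M PM; apply: cle_trans La _.
pose lt' (x y : [set x | lt x a]) := lt (val x) (val y).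
apply: (@well_order_embed _ _ lt').
- exact: wf_inverse_image.
- move=> x y; rewrite /lt'; case: (tot (val x) (val y)) => [|[/val_inj|]]; auto.
- move=> b hb; apply: nQ; exists (val b).
  split; first exact: set_mem (valP b).
  exists M => //; apply: (cle_trans hb); apply/cleP.
  pose g (x : [set x | lt' x b]) : [set x | lt x (val b)] :=
    @inset _ [set x | lt x (val b)] _ (set_mem (valP x)).
  by exists g => x y /(congr1 val)/= /val_inj/val_inj.
Qed.

Lemma leastP (P : cardinal -> Prop) : (exists K, P K) -> is_least P (least P).
Proof.
move=> /exists_least h; rewrite /least; case: pselect => // h'.
by case: (cid h').
Qed.

(** Cantor's diagonal argument, for an injection of the power set into [K]. *)
Lemma clt_pow (K : cardinal) : K <c set K.
Proof.
apply: cltNge => /cleP[f fI].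
pose D := [set x | exists2 A : set K, f A = x & ~ A x].
have ND : ~ D (f D) by move=> DD; case: (DD) => A /fI ->; apply.
by apply: (ND); exists D.
Qed.

Lemma csuccP (K : cardinal) : is_least (fun L => K <c L) (csucc K).
Proof. by apply: leastP; exists (set K); exact: clt_pow. Qed.

Lemma cltW (K L : cardinal) : K <c L -> K <=c L.
Proof. by case. Qed.

Lemma csucc_le (K L : cardinal) : csucc K <=c L <-> K <c L.
Proof.
have [[h1 h2] h3] := csuccP K; split; last exact: h3.
by move=> h; split; [exact: cle_trans h | move=> h4; apply: h2; exact: cle_trans h4].
Qed.

Lemma cle_lt_trans (K L M : cardinal) : K <=c L -> L <c M -> K <c M.
Proof.
move=> KL [LM ML]; split; first exact: cle_trans LM.
by move=> MK; apply: ML; exact: cle_trans KL.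
Qed.

Lemma csucc_homo (K L : cardinal) : K <=c L -> csucc K <=c csucc L.
Proof.
by move=> KL; apply/csucc_le/(cle_lt_trans KL)/csucc_le; exact: cle_refl.
Qed.

(** If some proper initial segment of a well-order is as large as [T], inject [T] into the shortest
    such segment and pull the order back; a large segment of the new order would yield a shorter
    one. *)
Lemma exists_initial_well_order (T : Type) : exists lt : T -> T -> Prop,
  [/\ well_founded lt, (forall a b c, lt a b -> lt b c -> lt a c),
      (forall a b, lt a b \/ a = b \/ lt b a) &
      forall a, ~ T <=c [set x | lt x a]].
Proof.
have [lt [wf tr tot]] := exists_well_order T.
have [[a Qa]|nQ] := pselect (exists a, T <=c [set x | lt x a]); last first.
  by exists lt; split=> // a ha; apply: nQ; exists a.
elim/(well_founded_ind wf) : a Qa => a IH Qa.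
have [[b [ba Qb]]|nQ] := pselect (exists b, lt b a /\ T <=c [set x | lt x b]).
  exact: IH Qb.
have /cleP[f fI] := Qa.
exists (fun x y => lt (val (f x)) (val (f y))); split.
- exact: wf_inverse_image.
- by move=> x y z; exact: tr.
- move=> x y; case: (tot (val (f x)) (val (f y))) => [|[/val_inj/fI|]]; auto.
- move=> x hx; apply: nQ; exists (val (f x)).
  split; first exact: set_mem (valP (f x)).
  apply: cle_trans hx _; apply/cleP.
  pose g (y : [set y | lt (val (f y)) (val (f x))]) : [set y | lt y (val (f x))] :=
    @inset _ [set y | lt y (val (f x))] _ (set_mem (valP y)).
  by exists g => y z /(congr1 val)/= /val_inj/fI/val_inj.
Qed.

(** * Infinite cardinals: absorption, squares and finite sequences *)

Lemma infinite_nat (K : cardinal) : infinite_set [set: K] <-> nat <=c K.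
Proof. exact: infiniteP. Qed.

Lemma cle_infinite (K L : cardinal) :
  K <=c L -> infinite_set [set: K] -> infinite_set [set: L].
Proof. by move=> KL iK fL; apply: iK; exact: cle_finite fL. Qed.

(** Hilbert's hotel: a shift along an embedded copy of [nat] frees [g 0] for [None]. *)
Lemma cle_option (K : cardinal) : infinite_set [set: K] -> option K <=c K.
Proof.
move=> /infinite_nat/cleP[g gI]; apply/cleP.
pose s x := if pselect (exists n, g n = x) is left h then g (projT1 (cid h)).+1
            else x.
have sg n : s (g n) = g n.+1.
  rewrite /s; case: pselect => [h|[]]; last by exists n.
  by case: cid => m /= /gI ->.
have sN x : ~ (exists n, g n = x) -> s x = x by rewrite /s; case: pselect.
exists (fun o => if o is Some x then s x else g 0%N).
have s0 x : s x <> g 0%N.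
  have [[n <-]|h] := pselect (exists n, g n = x); first by rewrite sg => /gI.
  by rewrite sN // => xg; apply: h; exists 0%N.
move=> [x|] [y|] //; last 2 first.
- by move/s0.
- by move/esym/s0.
have [[n <-]|h] := pselect (exists n, g n = x);
  have [[m <-]|h'] := pselect (exists n, g n = y); rewrite ?sg.
- by move=> /gI[->].
- by rewrite sN // => e; case: h'; exists n.+1.
- by rewrite sN // => e; case: h; exists m.+1.
- by rewrite !sN // => ->.
Qed.

Lemma option_finite (L : cardinal) :
  finite_set [set: L] -> finite_set [set: option L].
Proof.
move=> fL; have -> : [set: option L] = None |` (some @` setT).
  by rewrite eqEsubset; split=> // -[x|] _; [right; exists x | left].
by rewrite finite_setU; split; [exact: finite_set1 | exact: finite_image].
Qed.

Lemma option_small (K L : cardinal) :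
  infinite_set [set: K] -> ~ K <=c L -> ~ K <=c option L.
Proof.
move=> iK KL Ko; have [fL|iL] := pselect (finite_set [set: L]).
  by apply: iK; apply: cle_finite Ko _; exact: option_finite.
by apply: KL; apply: cle_trans Ko _; exact: cle_option.
Qed.

Lemma closed_segment_small (T W : Type) (lt : W -> W -> Prop) (a : W) :
  infinite_set [set: T] -> ~ T <=c [set x | lt x a] ->
  ~ T <=c [set x | lt x a \/ x = a].
Proof.
move=> iT sa TS; apply: (option_small iT sa); apply: cle_trans TS _; apply/cleP.
exists (fun s : [set x | lt x a \/ x = a] =>
  if pselect (lt (val s) a) is left h then
    Some (@inset _ [set x | lt x a] _ h) else None) => s t.
have := set_mem (valP t); have := set_mem (valP s) => /=.
case: pselect => hs; case: pselect => ht //; first by move=> _ _ [] /val_inj.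
by case=> // es; case=> // et _; apply: val_inj; exact: etrans (esym et).
Qed.

Lemma prod_homo (A B C D : cardinal) :
  A <=c C -> B <=c D -> (A * B)%type <=c (C * D)%type.
Proof.
move=> /cleP[f fI] /cleP[g gI]; apply/cleP; exists (fun p => (f p.1, g p.2)).
by move=> [a b] [c d] /= [/fI -> /gI ->].
Qed.

Lemma finite_prod (A B : cardinal) :
  finite_set [set: A] -> finite_set [set: B] -> finite_set [set: A * B].
Proof. by move=> fA fB; rewrite -setXTT; exact: finite_setX. Qed.

(* Hessenberg's theorem, for a least counterexample: ordering pairs by their
   maximum, every proper initial segment has fewer than [K] elements. *)
Lemma cle_square (K : cardinal) : infinite_set [set: K] -> (K * K)%type <=c K.
Proof.
move=> iK; apply: contrapT => nK.
have [{iK nK}K [[iK nK] Kmin]] : exists K, is_least (fun K => infinite_set [set: K] /\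
    ~ (K * K)%type <=c K) K by apply: exists_least; exists K.
apply: nK; have [lt [wf tr tot small]] := exists_initial_well_order K.
pose mx (p : K * K) := if pselect (lt p.1 p.2) then p.2 else p.1.
pose le x y := lt x y \/ x = y.
have le_mx p : le p.1 (mx p) /\ le p.2 (mx p).
  rewrite /mx /le; case: pselect => [|/=]; first by auto.
  by case: (tot p.1 p.2) => [//|[->|]]; auto.
have le_tr x y z : le x y -> le y z -> le x z.
  by move=> [xy|->] // [yz|<-]; left => //; exact: tr yz.
pose lt1 := slexprod K K lt lt; pose lt2 := slexprod K (K * K) lt lt1.
have tot1 p q : lt1 p q \/ p = q \/ lt1 q p.
  case: p q => [a b] [c d]; case: (tot a c) => [h|[<-|h]].
  - by left; left.
  - by case: (tot b d) => [h|[<-|h]]; [left; right | right; left | right; right; right].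
  - by right; right; left.
pose ltp p q := lt2 (mx p, p) (mx q, q).
have ltp_mx p q : ltp p q -> le (mx p) (mx q).
  by move=> h; inversion h; [left | right].
apply: (@well_order_embed _ _ ltp).
- apply: (wf_inverse_image _ _ _ (fun p => (mx p, p))).
  exact: (wf_slexprod _ _ _ _ wf (wf_slexprod _ _ _ _ wf wf)).
- move=> p q; case: (tot (mx p) (mx q)) => [h|[h|h]].
  + by left; left.
  + rewrite /ltp h; case: (tot1 p q) => [h1|[<-|h1]].
    * by left; right.
    * by right; left.
    * by right; right; right.
  + by right; right; left.
move=> q hq; pose S := [set x | le x (mx q)].
have {}hq : K <=c (S * S)%type.
  apply: cle_trans hq _; apply/cleP.
  have h1 (p : [set p | ltp p q]) : S (val p).1.
    apply: le_tr (ltp_mx _ _ (set_mem (valP p))); exact: (le_mx _).1.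
  have h2 (p : [set p | ltp p q]) : S (val p).2.
    apply: le_tr (ltp_mx _ _ (set_mem (valP p))); exact: (le_mx _).2.
  exists (fun p => (inset (h1 p), inset (h2 p))).
  by move=> x y [e1 e2]; apply: val_inj; exact: injective_projections.
have [fS|iS] := pselect (finite_set [set: S]).
  by apply: iK; apply: cle_finite hq _; exact: finite_prod.
(* If [S] were smaller than [K], minimality of [K] would give [S * S <=c S], and [hq] would bound
   [K] by [S] after all. *)
have KS : K <=c S.
  apply: contrapT => h; apply: (h); apply: Kmin; split=> // SS; apply: h.
  exact: cle_trans hq SS.
exact: (closed_segment_small iK (small (mx q)) KS).
Qed.

Lemma cle_prod (A B K : cardinal) : infinite_set [set: K] ->
  A <=c K -> B <=c K -> (A * B)%type <=c K.
Proof. by move=> iK AK BK; apply: cle_trans (prod_homo AK BK) (cle_square iK). Qed.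

Lemma cle_seq (K : cardinal) : infinite_set [set: K] -> seq K <=c K.
Proof.
move=> iK; have /cleP[p pI] := cle_square iK.
have [k0 _] := infinite_setN0 iK.
(* Iterated pairing is injective only on lists of equal length, so the length is recorded as
   well. *)
pose g := fix g (s : seq K) := if s is x :: s' then p (x, g s') else k0.
have gI s t : size s = size t -> g s = g t -> s = t.
  elim: s t => [|x s IH] [|y t] //= [st] /pI[-> gst].
  by rewrite (IH _ st gst).
apply: (@cle_trans _ (nat * K)%type).
  by apply/cleP; exists (fun s => (size s, g s)) => s t [/gI h /h].
by apply: cle_prod => //; [exact/infinite_nat | exact: cle_refl].
Qed.

Lemma clt_nge (K L : cardinal) : K <c L <-> ~ L <=c K.
Proof. by split; [case | exact: cltNge]. Qed.

(** * Order of a collection and reduced point character *)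

Section CollOrder.
Variable T : Type.
Implicit Types E D : set (set T).

Lemma coll_orderP E :
  (exists n, order_is_nat E n /\ coll_order E = 'I_n) \/
  (~ (exists n, order_is_nat E n) /\
   is_least (fun L => forall K, (exists D, [/\ D `<=` E, \bigcap_(A in D) A !=set0
     & K =c csucc D]) -> K <=c L) (coll_order E)).
Proof.
rewrite /coll_order; case: pselect => [h|h]; last first.
  right; split=> //; apply: leastP; exists (csucc (set T -> Prop)).
  move=> K [D [_ _ /ceqP[KD _]]]; apply: (cle_trans KD); apply: csucc_homo.
  apply/(cle_trans (cle_setT D))/cltW; exact: clt_pow.
by left; case: cid => n hn /=; exists n.
Qed.

Lemma coll_order_ge E D :
  D `<=` E -> \bigcap_(A in D) A !=set0 -> D <=c coll_order E.
Proof.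
move=> DE D0; have [[n [[_ h] ->]]|[_ [h _]]] := coll_orderP E; first exact: h.
apply: (@cle_trans _ (csucc D)); first by apply/cltW/csucc_le; exact: cle_refl.
by apply: h; exists D; split=> //; apply/ceqP; split; exact: cle_refl.
Qed.

Lemma cle_ord (n m : nat) : 'I_n <=c 'I_m <-> (n <= m)%N.
Proof.
split=> [|nm]; last first.
  apply/cleP; exists (widen_ord nm) => x y /(congr1 val)/= xy; exact: val_inj.
by move=> /cleP[f fI]; have := leq_card f fI; rewrite !card_ord.
Qed.

Lemma cle_ord_infinite (n : nat) (K : cardinal) :
  infinite_set [set: K] -> 'I_n <=c K.
Proof.
move=> /infinite_nat; apply: cle_trans; apply/cleP.
by exists (@nat_of_ord n); exact: ord_inj.
Qed.

(** Strict bounds on the subcollections suffice, since [D <c K] already gives [csucc D <=c K]; an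
    order that is a natural number is below [K] because [K] is infinite. *)
Lemma coll_order_le E (K : cardinal) : infinite_set [set: K] ->
  (forall D, D `<=` E -> \bigcap_(A in D) A !=set0 -> D <c K) ->
  coll_order E <=c K.
Proof.
move=> iK h; have [[n [_ ->]]|[_ [_ hl]]] := coll_orderP E.
  exact: cle_ord_infinite.
apply: hl => L [D [DE D0 /ceqP[LD _]]]; apply: (cle_trans LD); apply/csucc_le.
exact: h.
Qed.

End CollOrder.

Lemma exists_max_nat (P : nat -> Prop) (n : nat) : P 0%N ->
  (forall m, P m -> (m <= n)%N) -> exists2 m, P m & forall k, P k -> (k <= m)%N.
Proof.
move=> P0 Pn; have [|m hm|m /asboolP Pm hm] := @ex_maxnP (fun k => `[< P k >]) n.
- by exists 0%N; apply/asboolP.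
- by apply: Pn; exact/asboolP.
- by exists m => // k Pk; apply: hm; apply/asboolP.
Qed.

Lemma cle_ord_ceq (K : cardinal) (n : nat) : K <=c 'I_n -> exists m, K =c 'I_m.
Proof.
move=> h; have : finite_set [set: K] by apply: cle_finite h _; exact: finite_finset.
move=> [m hm]; exists m; rewrite /ceq; apply: card_eq_trans hm _; exact: card_II.
Qed.

(* The empty subcollection has the whole type as intersection, so [T] has to be
   inhabited. *)
Lemma coll_order_homo (T : Type) (x0 : T) (E F : set (set T)) :
  (forall D, D `<=` E -> \bigcap_(A in D) A !=set0 ->
    exists D', [/\ D' `<=` F, \bigcap_(A in D') A !=set0 & D <=c D']) ->
  coll_order E <=c coll_order F.
Proof.
move=> EF.
have up (D : set (set T)) : D `<=` E -> \bigcap_(A in D) A !=set0 ->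
    D <=c coll_order F.
  move=> DE D0; have [D' [D'F D'0 DD']] := EF _ DE D0.
  by apply: (cle_trans DD'); exact: coll_order_ge.
have [[n [[[D [DE D0 /ceqP[_ nD]]] _] ->]]|[nE [_ hl]]] := coll_orderP E.
  by apply: (cle_trans nD); exact: up.
have [[n [[_ hn] nE']]|[nF [hF _]]] := coll_orderP F.
  (* The sizes of the subcollections of [E] with a common point are bounded by [n], so a largest one
     exists and [E] would have a natural number as its order. *)
  exfalso; apply: nE; rewrite nE' in up.
  pose P m := exists D : set (set T),
    [/\ D `<=` E, \bigcap_(A in D) A !=set0 & D =c 'I_m].
  have [|m [D [DE D0 /ceqP[_ mD]]]|m Pm maxm] := @exists_max_nat P n.
  - exists set0; split; first by [].
      by exists x0 => A [].
    apply: (@card_eq_trans _ _ _ _ `I_0); last exact: card_II.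
    rewrite II0 card_eq0; apply/eqP; rewrite eqEsubset; split=> // x _.
    by case: (set_mem (valP x)).
  - by apply/cle_ord; apply: (cle_trans mD); exact: up.
  exists m; split=> // D DE D0.
  have [k Dk] := cle_ord_ceq (up _ DE D0).
  have /ceqP[Dk' _] := Dk; apply: (cle_trans Dk').
  by apply/cle_ord; apply: maxm; exists D.
apply: hl => K [D [DE D0 /ceqP[KD _]]]; apply: (cle_trans KD).
have [D' [D'F D'0 DD']] := EF _ DE D0; apply: (cle_trans (csucc_homo DD')).
by apply: hF; exists D'; split=> //; apply/ceqP; split; exact: cle_refl.
Qed.

Section ReducedPointCharacter.
Variables (R : realType) (T : pseudoMetricType R).
Implicit Types (M N : set T) (U V : set (set T)).

Lemma rpcP M : is_least (fun K => forall U, uniform_covering M U ->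
  exists V, [/\ uniform_covering M V, refines V U & coll_order V <=c K]) (rpc M).
Proof.
(* Every covering refines itself, and this cardinal bounds the order of any collection of subsets of
   [T]; the summand [nat] makes it infinite. *)
apply: leastP; exists (csucc (nat + set (set T))%type) => U hU; exists U; split=> //.
  by move=> A UA; exists A.
have [[h _] _] := csuccP (nat + set (set T))%type.
apply: coll_order_le => [|D _ _].
  apply/infinite_nat; apply: cle_trans h.
  by apply/cleP; exists inl => x y [].
apply/csucc_le/csucc_homo; apply: (cle_trans (cle_setT D)).
apply/(cle_trans (cltW (clt_pow _)))/cleP.
by exists inr => x y [].
Qed.

(** Adding the complement of [M] in [N] to each member turns a uniform covering of [M] into one of
    [N]. A refinement of the latter is then traced on [M]; distinct traces come from distinct sets,
    so the order does not grow. *)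
Lemma rpc_homo M N : M !=set0 -> M `<=` N -> rpc M <=c rpc N.
Proof.
move=> [m0 Mm0] MN; have [_ least_M] := rpcP M; have [hN _] := rpcP N.
apply: least_M => U [UM [r r0 Ur]].
have [U' [[U'N [d d0 U'd]] U'U ordU']] : exists V, [/\ uniform_covering N V,
    refines V [set A `|` (N `\` M) | A in U] & coll_order V <=c rpc N].
  apply: hN; split.
    rewrite /covering eqEsubset; split=> [x [_ [A UA <-] [Ax|[]//]]|x Nx].
      by apply: MN; rewrite -UM; exists A.
    have [A UA Am0] : (\bigcup_(A in U) A) m0 by rewrite UM.
    have [|Mx] := pselect (M x); last by exists (A `|` (N `\` M)); [exists A|right].
    by rewrite -{1}UM => -[B UB Bx]; exists (B `|` (N `\` M)); [exists B|left].
  (* A ball of radius [r / 2] that meets [M] lies in the [r]-ball about a point of [M]; one that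
     misses [M] lies in the added complement. *)
  exists (r / 2); first exact: divr_gt0.
  move=> _ [x Nx <-].
  have [[y [xy My]]|h] := pselect (exists y, ball x (r / 2) y /\ M y).
    have [A UA yA] := Ur _ (ex_intro2 _ _ y My erefl).
    exists (A `|` (N `\` M)); first by exists A.
    move=> z [xz Nz]; have [Mz|Mz] := pselect (M z); last by right.
    left; apply: yA; split=> //; rewrite [r]splitr.
    by apply: ball_triangle xz; exact: ball_sym.
  have [A UA Am0] : (\bigcup_(A in U) A) m0 by rewrite UM.
  exists (A `|` (N `\` M)); first by exists A.
  by move=> z [xz Nz]; right; split=> // Mz; apply: h; exists z.
exists [set A `&` M | A in U']; split.
- split.
    rewrite /covering eqEsubset; split=> [x [_ [A _ <-] []]//|x Mx].
    have [A U'A Ax] : (\bigcup_(A in U') A) x by rewrite U'N; exact: MN.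
    by exists (A `&` M); first by exists A.
  exists d => // _ [x Mx <-]; have [A U'A xA] := U'd _ (ex_intro2 _ _ x (MN _ Mx) erefl).
  exists (A `&` M); first by exists A.
  by move=> z [xz Mz]; split=> //; apply: xA; split=> //; exact: MN.
- move=> _ [A U'A <-]; have [_ [B UB <-] AB] := U'U _ U'A; exists B => //.
  by move=> z [Az Mz]; have [|[]] := AB z Az.
- apply: cle_trans ordU'; apply: (coll_order_homo m0) => D DV [x Dx].
  pose g (A : D) : set T := projT1 (cid2 (DV _ (set_mem (valP A)))).
  have gP A : U' (g A) /\ g A `&` M = val A by rewrite /g; case: cid2.
  exists (range g); split.
  + by move=> _ [A _ <-]; case: (gP A).
  + exists x => _ [A _ <-]; have := Dx _ (set_mem (valP A)).
    by have [_ <-] := gP A; case.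
  + apply/cleP; exists (fun A => @inset _ (range g) (g A) (ex_intro2 _ _ A I erefl)).
    move=> A B /(congr1 val)/= gAB; apply: val_inj.
    by case: (gP A) => _ <-; case: (gP B) => _ <-; rewrite gAB.
Qed.

Lemma dense_ball (D : set T) (x : T) (r : R) : dense D -> 0 < r ->
  exists2 y, D y & ball x r y.
Proof.
move=> dD r0; have [|y [xy Dy]] := dD _ _ (open_interior (ball x r)).
  by exists x; exact: nbhsx_ballx.
by exists y => //; exact: interior_subset xy.
Qed.

Lemma rpc_le_dense (D : set T) (K : cardinal) : infinite_set [set: K] ->
  dense D -> K =c D -> rpc [set: T] <=c K.
Proof.
move=> iK dD /ceqP[KD DK]; have [_] := rpcP setT; apply=> U [UT [r r0 Ur]].
have [lt [wf tr tot small]] := exists_initial_well_order D.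
pose s := r / 3; have s0 : 0 < s by exact: divr_gt0.
pose V (i : D) := ball (val i) (s + s + s) `\`
  \bigcup_(j in [set j | lt j i]) ball (val j) s.
have rs : r = s + s + s by rewrite /s; lra.
(* Take the first centre within [s + s] of [x]: an earlier [j] whose [s]-ball met [ball x s] would
   itself be that close to [x]. *)
have Vball x : exists i, ball x s `<=` V i.
  have [y Dy xy] := dense_ball x dD (addr_gt0 s0 s0).
  pose P (i : D) := ball x (s + s) (val i).
  have : P (inset Dy) by [].
  elim/(well_founded_ind wf) : (inset Dy) => i IH Pi.
  have [[j [ji Pj]]|h] := pselect (exists j, lt j i /\ P j); first exact: IH Pj.
  exists i => z xz; split.
    by apply: ball_triangle xz; exact: ball_sym.
  move=> [j /= ji jz]; apply: h; exists j; split=> //.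
  by apply: ball_triangle xz (ball_sym jz).
exists (range V); split.
- split.
    rewrite /covering eqEsubset; split=> // x _; have [i xi] := Vball x.
    by exists (V i) => //; apply: xi; exact: ballxx.
  exists s => // _ [x _ <-]; have [i xi] := Vball x; exists (V i) => //.
  by move=> z [/xi].
- move=> _ [i _ <-]; have [A UA iA] := Ur _ (ex_intro2 _ _ (val i) I erefl).
  by exists A => // z [iz _]; apply: iA; rewrite rs.
- apply: coll_order_le => // E EV [x Ex]; apply/clt_nge => KE.
  (* No set with an index after [y] contains [x], because [ball y s] is removed from it; the other
     indices form a closed segment of an initial order, which is smaller than [D]. *)
  have [y Dy xy] := dense_ball x dD s0.
  have iD : infinite_set [set: D] := cle_infinite KD iK.
  apply: (closed_segment_small iD (small (inset Dy))).
  apply: cle_trans DK _; apply: (cle_trans KE).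
  pose g (A : E) : D := projT1 (cid2 (EV _ (set_mem (valP A)))).
  have gP A : V (g A) = val A by rewrite /g; case: cid2.
  have gle A : lt (g A) (inset Dy) \/ g A = inset Dy.
    case: (tot (g A) (inset Dy)) => [|[|h]]; auto.
    have := Ex _ (set_mem (valP A)); rewrite -gP => -[_ []].
    by exists (inset Dy) => //=; exact: ball_sym.
  apply/cleP; exists (fun A => @inset _ [set i | lt i (inset Dy) \/ i = inset Dy] _ (gle A)).
  by move=> A B /(congr1 val)/= gAB; apply: val_inj; rewrite -!gP gAB.
Qed.

End ReducedPointCharacter.

Lemma densP (T : topologicalType) :
  is_least (fun K => exists D : set T, dense D /\ K =c D) (dens T).
Proof.
apply: leastP; exists [set: T], setT; split; last by apply/ceqP; split; exact: cle_refl.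
by move=> O [x Ox] _; exists x.
Qed.

(** * The cardinals omega_alpha *)

Lemma next_infiniteP (I : cardinal) (f : I -> cardinal) :
  is_least (fun K => infinite_set [set: K] /\ forall i, f i <c K) (next_infinite f).
Proof.
apply: leastP; exists (set (nat + {i & f i})%type); split.
  apply/infinite_nat; apply: cle_trans (cltW (clt_pow _)).
  by apply/cleP; exists inl => x y [].
move=> i; apply: cle_lt_trans (clt_pow _); apply/cleP.
exists (fun x => inr (existT _ i x)) => x y [xy].
by have /= := projT2_eq xy; rewrite (Prop_irrelevance (projT1_eq xy) erefl).
Qed.

Lemma next_infinite_infinite (I : cardinal) (f : I -> cardinal) :
  infinite_set [set: next_infinite f].
Proof. by have [[]] := next_infiniteP f. Qed.

Lemma next_infinite_gt (I : cardinal) (f : I -> cardinal) (i : I) :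
  f i <c next_infinite f.
Proof. by have [[_]] := next_infiniteP f. Qed.

Section Omega.
Variable alpha : ordinal_number.

Lemma omega_belowE (a : alpha) : omega_below a =
  next_infinite (fun b : {b : alpha | olt b a} => omega_below (proj1_sig b)).
Proof.
rewrite /omega_below Fix_eq // => x f g fg.
by have -> : f = g by apply: functional_extensionality_dep => y;
  apply: functional_extensionality_dep.
Qed.

Lemma omega_below_infinite (a : alpha) : infinite_set [set: omega_below a].
Proof. by rewrite omega_belowE; exact: next_infinite_infinite. Qed.

Lemma omega_below_homo (a b : alpha) : olt b a -> omega_below b <c omega_below a.
Proof.
move=> ba; rewrite [omega_below a]omega_belowE.
exact: (next_infinite_gt
  (fun b : {b : alpha | olt b a} => omega_below (proj1_sig b)) (exist _ b ba)).
Qed.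

Lemma omega_below_lt (a : alpha) : omega_below a <c omega_ alpha.
Proof. exact: next_infinite_gt. Qed.

Lemma omega_infinite : infinite_set [set: omega_ alpha].
Proof. exact: next_infinite_infinite. Qed.

Lemma exists_omega_chain (K : cardinal) : limit_ordinal alpha ->
  K <c omega_ alpha -> exists L : nat -> cardinal,
  [/\ K <=c L 0%N, forall n, infinite_set [set: L n], forall n, L n <c L n.+1 &
      forall n, L n <c omega_ alpha].
Proof.
move=> [[a0] lim] /clt_nge Klt.
(* Otherwise [K] would be an infinite cardinal above every [omega_below a], hence at least
   [omega_ alpha]. *)
have [a Ka] : exists a : alpha, K <=c omega_below a.
  apply: contrapT => h; apply: Klt.
  have hK (a : alpha) : omega_below a <c K by apply/clt_nge => aK; apply: h; exists a.
  have [_] := next_infiniteP (@omega_below alpha); apply; split; last exact: hK.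
  apply: (cle_infinite (cltW (hK a0))); exact: omega_below_infinite.
pose next (b : alpha) := projT1 (cid (lim b)).
exists (fun n => omega_below (iter n next a)); split=> // n.
- exact: omega_below_infinite.
- by apply: omega_below_homo; rewrite /= /next; case: cid.
- exact: omega_below_lt.
Qed.

End Omega.

(** * Monochromatic boxes *)

Section Box.
Variable L : nat -> cardinal.

(** Level 0 supplies no coordinate: [L 0] is reserved for counting colours. *)
Fixpoint tup (n : nat) : cardinal := if n is m.+1 then (L m.+1 * tup m)%type else unit.

Fixpoint tup_neq (n : nat) : tup n -> tup n -> Prop :=
  if n is m.+1 then fun t u => t.1 <> u.1 /\ tup_neq t.2 u.2 else fun _ _ => True.

(** As [e] varies, these are the vertices of the box with opposite corners [t] and [u]. *)
Fixpoint mix (n : nat) (e : nat -> bool) : tup n -> tup n -> tup n :=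
  if n is m.+1 then
    fun t u => (if e m then u.1 else t.1, mix e t.2 u.2)
  else fun t _ => t.

(* [g] witnesses that at most [L 0] colours occur on a line parallel to an axis. *)
Fixpoint line_small (V : Type) (n : nat) : (tup n -> V) -> Prop :=
  if n is m.+1 then fun c =>
    (forall x, line_small (fun t => c (x, t))) /\
    forall t, exists g : L m.+1 -> L 0%N, forall x y, g x = g y -> c (x, t) = c (y, t)
  else fun _ => True.

Hypothesis Linf : forall n, infinite_set [set: L n].
Hypothesis Llt : forall n, L n <c L n.+1.

Lemma cle_chain (n m : nat) : (n <= m)%N -> L n <=c L m.
Proof.
move=> /subnK <-; elim: (m - n)%N => [|k IH]; first exact: cle_refl.
by apply: (cle_trans IH); exact: cltW.
Qed.

Lemma tup_le (n : nat) : tup n <=c L n.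
Proof.
elim: n => [|n IH] /=; last first.
  by apply: cle_prod => //; [exact: cle_refl | apply: cle_trans IH (cltW _)].
have [x _] := infinite_setN0 (@Linf 0%N).
by apply/cleP; exists (fun=> x) => -[] [].
Qed.

(* Two elements of the top level carry the same monochromatic box of the lower
   levels, with the same colour, because the boxes and the colours seen by a
   fixed tuple are fewer than the elements of the top level. *)
Lemma exists_monochromatic_box (V : Type) (n : nat) (c : tup n -> V) :
  line_small c -> exists t u, tup_neq t u /\ forall e, c (mix e t u) = c t.
Proof.
elim: n c => [c _|n IH c [c_low c_top]]; first by exists tt, tt.
have box x : exists p : tup n * tup n, tup_neq p.1 p.2 /\
    forall e, c (x, mix e p.1 p.2) = c (x, p.1).
  by have [t [u h]] := IH _ (c_low x); exists (t, u).
pose b x := projT1 (cid (box x)).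
have bP x : tup_neq (b x).1 (b x).2 /\
    forall e, c (x, mix e (b x).1 (b x).2) = c (x, (b x).1).
  by rewrite /b; case: (cid (box x)).
pose g t := projT1 (cid (c_top t)).
have gP t x y : g t x = g t y -> c (x, t) = c (y, t).
  by rewrite /g; case: (cid (c_top t)) => /= g' h; exact: h.
pose h x := (b x, g (b x).1 x).
have small : (tup n * tup n * L 0%N)%type <=c L n.
  apply: cle_prod => //; last exact: cle_chain.
  by apply: cle_prod => //; exact: tup_le.
have [x [y [xy [bxy gxy]]]] : exists x y, x <> y /\ h x = h y.
  apply: contrapT => hinj; have /clt_nge := Llt n; apply; apply: cle_trans small.
  apply/cleP; exists h => x y hxy; apply: contrapT => xy.
  by apply: hinj; exists x, y.
have [nb cx] := bP x; have [_ cy] := bP y.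
rewrite -bxy in gxy cy.
exists (x, (b x).1), (y, (b x).2); split=> // e /=.
by case: (e n); rewrite ?cx // cy; apply: gP.
Qed.

End Box.

(** * Coverings of large balls *)

Lemma cle_set_inj (T : Type) (A : set T) (K : cardinal) (k0 : K) : A <=c K ->
  exists f : T -> K, forall x y, A x -> A y -> f x = f y -> x = y.
Proof.
move=> /cleP[f fI].
exists (fun x => if pselect (A x) is left h then f (inset h) else k0) => x y.
by case: pselect => // Ax; case: pselect => // Ay _ _ /fI/(congr1 val).
Qed.

Section Covers.
Variables (R : realType) (X : normedModType R).

(* [eta] is a Lebesgue number of the covering; the covering is indexed, so that
   the bound on the multiplicity also counts repeated members. *)
Definition controlled_cover (kappa : cardinal) (rho d eta : R) : Prop :=
  exists (I : cardinal) (A : I -> set X) (c : I -> X),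
  [/\ forall i y, A i y -> `|c i - y| < d,
      forall x, `|x| <= rho -> exists i, forall y, `|y| <= rho -> `|x - y| < eta -> A i y &
      forall x, [set i | A i x] <=c kappa].

(** The uniform covering by [r]-balls is refined with order at most [kappa]; the members through [x]
    have a common point, so the order bounds their number. *)
Lemma controlled_cover_ball (kappa : cardinal) (r : R) : 0 < r ->
  rpc (unit_ball X) <=c kappa ->
  exists2 delta, 0 < delta & controlled_cover kappa 1 r delta.
Proof.
move=> r0 hk; have [h _] := rpcP (unit_ball X).
have [|V [[VB [delta d0 Vd]] Vr ordV]] :=
    h [set ball x r `&` unit_ball X | x in unit_ball X].
  split; last by exists r => // A [x Bx <-]; exists (ball x r `&` unit_ball X) => //; exists x.
  rewrite /covering eqEsubset; split=> [x [_ [y _ <-] []]//|x Bx].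
  by exists (ball x r `&` unit_ball X); [exists x | split=> //; exact: ballxx].
exists delta => //.
have cP (A : V) : exists c, val A `<=` ball c r.
  have [_ [c _ <-] Ac] := Vr _ (set_mem (valP A)).
  by exists c => y /Ac[].
exists V, (fun A => val A), (fun A => projT1 (cid (cP A))); split.
- by move=> A y Ay; case: (cid (cP A)) => c /= /(_ _ Ay); rewrite -ball_normE.
- move=> x Bx; have [A VA xA] := Vd _ (ex_intro2 _ _ x Bx erefl).
  exists (inset VA) => y By xy; apply: xA; split=> //.
  by rewrite -ball_normE.
- move=> x; apply: cle_trans hk; apply: cle_trans ordV.
  pose D := [set A | V A /\ A x].
  apply: (@cle_trans _ D); last first.
    by apply: coll_order_ge => [A []//|]; exists x => A [].
  apply/cleP.
  exists (fun i : [set i : V | val i x] =>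
    @inset _ D _ (conj (set_mem (valP (val i))) (set_mem (valP i)))).
  by move=> i j /(congr1 val)/= /val_inj/val_inj.
Qed.

Lemma controlled_cover_scale (kappa : cardinal) (rho d eta s : R) : 0 < s ->
  controlled_cover kappa rho d eta ->
  controlled_cover kappa (s * rho) (s * d) (s * eta).
Proof.
move=> s0 [I [A [c [Ad Aleb Ak]]]].
have normV (y : X) : `|s^-1 *: y| = s^-1 * `|y|.
  by rewrite normrZ gtr0_norm ?invr_gt0.
exists I, (fun i => [set y | A i (s^-1 *: y)]), (fun i => s *: c i); split.
- move=> i y /= /Ad; rewrite -(ltr_pM2l s0) -{1}(gtr0_norm s0) -normrZ scalerBr.
  by rewrite scalerA divff ?scale1r // gt_eqF.
- move=> x xr; have [|i hi] := Aleb (s^-1 *: x); first by rewrite normV ler_pdivrMl.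
  exists i => y yr xy; apply: hi; first by rewrite normV ler_pdivrMl.
  by rewrite -scalerBr normV ltr_pdivrMl.
- by move=> x; exact: Ak.
Qed.

(* Covering each member of a first covering by a translate of a second one only
   squares the infinite bound on the multiplicity. *)
Lemma controlled_cover_refine (kappa : cardinal) (rho d d' eta eta' : R) :
  infinite_set [set: kappa] -> 0 < eta -> eta' <= eta ->
  controlled_cover kappa rho d eta -> controlled_cover kappa d d' eta' ->
  controlled_cover kappa rho d' eta'.
Proof.
move=> ik eta0 le_eta [I [A [c [Ad Aleb Ak]]]] [J [B [b [Bd Bleb Bk]]]].
exists (I * J)%type, (fun p => A p.1 `&` [set y | B p.2 (y - c p.1)]),
  (fun p => c p.1 + b p.2); split.
- move=> [i j] y [_ /= /Bd]; by rewrite opprB addrA (addrC (b j)).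
- move=> x xr; have [i hi] := Aleb x xr.
  have Aix : A i x by apply: hi; rewrite // subrr normr0.
  have [|j hj] := Bleb (x - c i); first by rewrite distrC; exact/ltW/Ad.
  exists (i, j) => y yr xy; have Aiy : A i y by apply: hi => //; exact: lt_le_trans le_eta.
  split=> //=; apply: hj; first by rewrite distrC; exact/ltW/Ad.
  by rewrite opprB addrA subrK.
- move=> x; pose C i : set J := [set j | B j (x - c i)].
  have [k0 _] := infinite_setN0 ik.
  (* For each [i], at most [kappa] members of the second covering contain [x - c i]; numbering them
     by [f i] makes [j] recoverable from [i] and [f i j]. *)
  pose f i := projT1 (cid (cle_set_inj k0 (Bk (x - c i) : C i <=c kappa))).
  have fI i j j' : C i j -> C i j' -> f i j = f i j' -> j = j'.
    by rewrite /f; case: cid => /= g; exact.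
  apply: (@cle_trans _ ([set i | A i x] * kappa)%type); last first.
    by apply: cle_prod => //; exact: cle_refl.
  pose P : set (I * J) := [set p | A p.1 x /\ C p.1 p.2].
  have P1 (p : P) : [set i | A i x] (val p).1 by have [] := set_mem (valP p).
  have P2 (p : P) : C (val p).1 (val p).2 by have [] := set_mem (valP p).
  apply/cleP; exists (fun p : P => (inset (P1 p), f (val p).1 (val p).2)) => p q [e1].
  move=> e2; apply: val_inj; apply: injective_projections => //.
  have hq := P2 q; rewrite -[(val q).1]e1 in e2 hq.
  exact: fI (P2 p) hq e2.
Qed.

(** Scaling covers the ball of radius [s] by sets of radius [s / 4]. Composing such coverings for
    powers of 4 brings the radius down to 1; the Lebesgue number is that of the finest stage,
    [s = 4], whatever [rho] is. *)
Lemma controlled_cover_unit (kappa : cardinal) :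
  infinite_set [set: kappa] -> rpc (unit_ball X) <=c kappa ->
  exists2 delta, 0 < delta & forall rho0, exists2 rho, rho0 <= rho &
    controlled_cover kappa rho 1 (4 * delta).
Proof.
move=> ik hk; have [|delta d0 C0] := @controlled_cover_ball kappa 4^-1 _ hk.
  by rewrite invr_gt0.
have Cs (s : R) : 0 < s -> controlled_cover kappa s (s / 4) (s * delta).
  by move=> s0; rewrite -{1}(mulr1 s); exact: controlled_cover_scale.
exists delta => // rho0.
(* Here [k.+1] stages lead from radius [rho] down to [4 ^+ j]. *)
have iter (k j : nat) (rho : R) : rho = 4 ^+ (k + j).+1 ->
    controlled_cover kappa rho (4 ^+ j) (4 ^+ j.+1 * delta).
  elim: k j => [|k IH] j rhoE.
    have -> : 4 ^+ j = rho / 4 by rewrite rhoE exprSr mulfK.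
    by rewrite -[j.+1]/(0 + j).+1 -rhoE; apply: Cs; rewrite rhoE exprn_gt0.
  apply: (@controlled_cover_refine _ _ (4 ^+ j.+1) _ (4 ^+ j.+2 * delta)) => //.
  - by rewrite mulr_gt0 // exprn_gt0.
  - by rewrite ler_pM2r // ler_weXn2l // ler1n.
  - by apply: IH; rewrite rhoE addSnnS.
  - have -> : 4 ^+ j = 4 ^+ j.+1 / 4 :> R by rewrite exprSr mulfK.
    by apply: Cs; rewrite exprn_gt0.
pose k := (Num.truncn `|rho0|).+1.
exists (4 ^+ (k + 0).+1); last first.
  by have := iter k 0%N _ erefl; rewrite expr0 expr1.
apply: (@le_trans _ _ `|rho0|); first exact: ler_norm.
apply: (@le_trans _ _ k%:R); first by rewrite ltW // truncnS_gt.
rewrite addn0 -natrX ler_nat; apply: ltnW; exact: leq_trans (ltn_expl _ _) (leq_pexp2l _ _).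
Qed.

End Covers.

(** * Separated sets and sums of small vectors *)

Section Density.
Variables (R : realType) (X : normedModType R).

Lemma exists_maximal_separated : exists S : set X,
  [/\ S `<=` unit_ball X, forall x y, S x -> S y -> x <> y -> 2^-1 <= `|x - y| &
      forall x, `|x| <= 1 -> exists2 s, S s & `|x - s| < 2^-1].
Proof.
pose sep (S : set X) :=
  S `<=` unit_ball X /\ forall x y, S x -> S y -> x <> y -> 2^-1 <= `|x - y|.
have [F FP Ftot|S [[SB Ssep] Smax]] := @Zorn_bigcup X sep.
  split=> [x [A /FP[AB _] /AB]//|x y [A FA Ax] [B FB By]].
  have [AB|BA] := Ftot _ _ FA FB.
    by have [_] := FP _ FB; apply=> //; exact: AB.
  by have [_] := FP _ FA; apply=> //; exact: BA.
exists S; split=> // x Bx; apply: contrapT => h.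
have far s : S s -> 2^-1 <= `|x - s|.
  by move=> Ss; rewrite leNgt; apply/negP => xs; apply: h; exists s.
have Sx : ~ S x by move=> /far; rewrite subrr normr0 leNgt invr_gt0 ltr0n.
apply: (Smax (S `|` [set x])).
  by split; [left | move=> /(_ x (or_intror erefl))].
split=> [y [/SB//|->//]|y z [Sy|->] [Sz|->]//].
- exact: Ssep.
- by move=> _; rewrite distrC; exact: far.
- by move=> _; exact: far.
Qed.

(** If [s] is within 1/2 of [x], then twice [x - s] is again in the unit ball. Iterating, the finite
    sums s_0 + s_1/2 + s_2/4 + ... approximate the unit ball, and their natural multiples all of
    [X]; there are at most [K] of these. *)
Lemma dens_le_separated (S : set X) (K : cardinal) : infinite_set [set: K] ->
  (forall x, `|x| <= 1 -> exists2 s, S s & `|x - s| < 2^-1) ->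
  S <=c K -> dens X <=c K.
Proof.
move=> iK net SK.
pose approx := foldr (fun (s : S) (y : X) => val s + 2^-1 *: y) 0.
have approxP (k : nat) (x : X) : `|x| <= 1 -> exists l, `|x - approx l| <= 2^-1 ^+ k.
  elim: k x => [|k IH] x x1; first by exists [::]; rewrite subr0 expr0.
  have [s Ss xs] := net _ x1; have [|l hl] := IH (2 *: (x - s)).
    by rewrite normrZ normr_nat -ler_pdivlMl // mulr1 ltW.
  exists (inset Ss :: l) => /=.
  have -> : x - (s + 2^-1 *: approx l) = 2^-1 *: (2 *: (x - s) - approx l).
    by rewrite scalerBr scalerA mulVf // scale1r opprD addrA.
  by rewrite normrZ gtr0_norm ?invr_gt0 // exprS ler_pM2l ?invr_gt0.
pose f (p : nat * seq S) : X := p.1%:R *: approx p.2.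
have fdense : dense (range f).
  move=> O [x Ox] Oopen; have /nbhs_ballP[e /= e0 xe] := open_nbhs_nbhs (conj Oopen Ox).
  (* Division by [N] brings [x] into the unit ball; [k] below is chosen to offset the factor [N] in
     the error. *)
  pose N := (Num.truncn `|x|).+1; have xN : `|x| < N%:R by exact: truncnS_gt.
  have N0 : 0 < N%:R :> R by rewrite ltr0n.
  have [k hk] : exists k, N%:R * 2^-1 ^+ k < e.
    pose k := (Num.truncn (N%:R / e)).+1; exists k.
    rewrite exprVn ltr_pdivrMr ?exprn_gt0 // mulrC -ltr_pdivrMr //.
    apply: (@lt_trans _ _ k%:R); first exact: truncnS_gt.
    by rewrite -natrX ltr_nat ltn_expl.
  have [|l hl] := @approxP k (N%:R^-1 *: x).
    by rewrite normrZ gtr0_norm ?invr_gt0 // ler_pdivrMl // mulr1 ltW.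
  exists (f (N, l)); split; last by exists (N, l).
  apply: xe; rewrite -ball_normE /=; apply: le_lt_trans hk.
  have -> : x - f (N, l) = N%:R *: (N%:R^-1 *: x - approx l).
    by rewrite scalerBr scalerA divff ?gt_eqF // scale1r.
  by rewrite normrZ gtr0_norm // ler_pM2l.
have [_ dmin] := densP X.
apply: (@cle_trans _ (range f)).
  by apply: dmin; exists (range f); split=> //; apply/ceqP; split; exact: cle_refl.
apply: (@cle_trans _ (nat * seq S)%type).
  apply: (@cle_surj _ _ (fun p => @inset _ (range f) (f p) (ex_intro2 _ _ p I erefl))).
  move=> [y hy]; have [p _ fp] := set_mem hy; exists p.
  by apply: val_inj.
apply: cle_prod => //; first exact/infinite_nat.
apply: cle_trans (cle_seq iK); have /cleP[g gI] := SK.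
by apply/cleP; exists (map g); exact: inj_map.
Qed.

End Density.

Section TupleSums.
Variables (R : realType) (X : normedModType R) (L : nat -> cardinal).
Variables (phi : forall m, L m.+1 -> X) (delta : R).

Fixpoint tsum (n : nat) : tup L n -> X :=
  if n is m.+1 then fun t => phi t.1 + tsum t.2 else fun _ => 0.

Hypothesis phi_le : forall m x, `|phi (m := m) x| <= 2 * delta.

Lemma tsum_le (n : nat) (t : tup L n) : `|tsum t| <= n%:R * (2 * delta).
Proof.
elim: n t => [t|n IH [x t]] /=; first by rewrite normr0 mul0r.
by rewrite -natr1 mulrDl mul1r addrC (le_trans (ler_normD _ _)) // lerD.
Qed.

(** The offset [z] collects the terms already fixed, for the induction. If only [phi x] varies, its
    norm is below [4 * delta], so each colour that occurs is a member containing [z + tsum t]. *)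
Lemma tsum_line_small (I : Type) (A : I -> set X) (col : X -> I) (rho : R)
    (n : nat) (z : X) :
  0 < delta ->
  (forall x, `|x| <= rho -> forall y, `|y| <= rho -> `|x - y| < 4 * delta ->
     A (col x) y) ->
  (forall x, [set i | A i x] <=c L 0%N) -> infinite_set [set: L 0%N] ->
  `|z| + n%:R * (2 * delta) <= rho ->
  line_small (fun t : tup L n => col (z + tsum t)).
Proof.
move=> d0 colP Asmall iL; elim: n z => [//|n IH] z zn /=; split=> [x|t].
  rewrite (_ : (fun t => _) = (fun t => col (z + phi x + tsum t))); last first.
    by apply: funext => t; rewrite /= addrA.
  apply: IH; apply: le_trans zn; rewrite -natr1.
  by have := ler_normD z (phi x); have := phi_le x; lra.
have [k0 _] := infinite_setN0 iL.
have [f fI] := cle_set_inj k0 (Asmall (z + tsum t)).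
have colA x : A (col (z + (phi x + tsum t))) (z + tsum t).
  have tl := tsum_le t; have px := phi_le x.
  have nS : n.+1%:R * (2 * delta) = n%:R * (2 * delta) + 2 * delta.
    by rewrite -natr1 mulrDl mul1r.
  apply: colP.
  - apply: le_trans (ler_normD _ _) _; apply: le_trans zn; rewrite lerD2l nS.
    by rewrite (le_trans (ler_normD _ _)) // addrC lerD.
  - apply: le_trans (ler_normD _ _) _; apply: le_trans zn; rewrite lerD2l nS.
    by rewrite (le_trans tl) // lerDl mulr_ge0 // ltW.
  - rewrite opprD addrACA subrr add0r addrK; apply: le_lt_trans px _.
    by rewrite ltr_pM2r // ltr_nat.
exists (fun x => f (col (z + (phi x + tsum t)))) => x y.
by apply: fI; exact: colA.
Qed.

(** Opposite vertices of the box differ in every coordinate, so each coordinate contributes the same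
    difference up to sign. *)
Lemma tsum_mixB (n : nat) (t u : tup L n) :
  (forall m x y, x <> y -> delta <= `|phi (m := m) x - phi y|) ->
  tup_neq t u -> exists d : nat -> X, (forall i, (i < n)%N -> delta <= `|d i|) /\
    forall e, tsum (mix e t u) - tsum (mix (fun i => ~~ e i) t u) =
              \sum_(i < n) (-1) ^+ e i *: d i.
Proof.
move=> sep; elim: n t u => [t u _|n IH [x t] [y u] /= [xy tu]].
  by exists (fun=> 0); split=> // e; rewrite big_ord0 subrr.
have [d [dn dE]] := IH _ _ tu.
exists (fun i => if i == n then phi x - phi y else d i); split.
  move=> i; rewrite ltnS leq_eqVlt; case: eqP => /= [_ _|_ /dn//]; exact: sep.
move=> e; rewrite big_ord_recr /= eqxx opprD addrACA dE addrC; congr (_ + _).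
  by apply: eq_bigr => i _; rewrite ltn_eqF.
by case: (e n); rewrite ?expr0 ?scale1r // expr1 scaleN1r opprB.
Qed.

End TupleSums.

(** * The lower bound *)

(** Such vectors make the left side of the cotype inequality grow without bound in [n], while its
    right side stays at most [C * B]. *)
Lemma cotype_unbounded (R : realType) (X : normedModType R) (q delta B : R) :
  0 < q -> has_cotype X q -> 0 < delta -> 0 <= B ->
  ~ (forall n, exists d : 'I_n -> X, (forall i, delta <= `|d i|) /\
       forall e : {ffun 'I_n -> bool}, `|\sum_(i < n) (-1) ^+ e i *: d i| <= B).
Proof.
move=> q0 [C C0 hC] d0 B0 H.
have dq0 : 0 < delta `^ q by exact: powR_gt0.
pose n := (Num.truncn ((C * B) `^ q / delta `^ q)).+1.
have [d [dge dle]] := H n.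
have nlt : (C * B) `^ q < n%:R * delta `^ q.
  by rewrite -ltr_pdivrMr //; exact: truncnS_gt.
have mono (a b r : R) : 0 <= r -> 0 <= a -> a <= b -> a `^ r <= b `^ r.
  move=> r0 a0 ab; apply: ge0_ler_powR => //; rewrite nnegrE //.
  exact: le_trans ab.
have powRK (a : R) : 0 <= a -> (a `^ q) `^ q^-1 = a.
  by move=> a0; rewrite -powRrM mulfV ?gt_eqF // powRr1.
have lhs : n%:R * delta `^ q <= \sum_(i < n) `|d i| `^ q.
  rewrite -[n in n%:R]card_ord mulr_natl -sumr_const; apply: ler_sum => i _.
  by apply: mono => //; exact: ltW.
have rhs : (\sum_(e : {ffun 'I_n -> bool})
    `|\sum_(i < n) (-1) ^+ e i *: d i| `^ q) / 2 ^+ n <= B `^ q.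
  rewrite ler_pdivrMr ?exprn_gt0 // mulrC -natrX.
  have -> : (2 ^ n = #|{ffun 'I_n -> bool}|)%N by rewrite card_ffun card_bool card_ord.
  rewrite mulr_natl -sumr_const; apply: ler_sum => e _.
  by apply: mono => //; exact: ltW.
have qV0 : 0 <= q^-1 by rewrite invr_ge0 ltW.
have : (n%:R * delta `^ q) `^ q^-1 <= C * B.
  apply: (le_trans (mono _ _ _ qV0 _ lhs)); first by rewrite mulr_ge0 // ltW.
  apply: (le_trans (hC n d)); rewrite ler_pM2l // -[leRHS](powRK B) //.
  apply: mono => //; rewrite mulr_ge0 ?invr_ge0 ?exprn_ge0 //.
  by apply: sumr_ge0 => e _; exact: powR_ge0.
move=> /(mono _ _ q (ltW q0) (powR_ge0 _ _)).
rewrite -powRrM mulVf ?gt_eqF // powRr1; last by rewrite mulr_ge0 // ltW.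
by rewrite leNgt nlt.
Qed.

Lemma omega_le_rpc_unit_ball (R : realType) (X : normedModType R)
    (alpha : ordinal_number) :
  nontrivial_cotype X -> limit_ordinal alpha -> omega_ alpha <=c dens X ->
  omega_ alpha <=c rpc (unit_ball X).
Proof.
move=> [q q2 hq] lim hdens; apply: contrapT => /cltNge Klt.
have [L [KL Linf Llt Lomega]] := exists_omega_chain lim Klt.
have [delta d0 covers] := controlled_cover_unit (Linf 0%N) KL.
have [S [SB Ssep Snet]] := exists_maximal_separated X.
(* If [S] embedded into [L n], then [dens X] would be at most [L n], which is below
   [omega_ alpha]. *)
have LS n : exists f : L n -> S, injective f.
  apply/cleP; case: (cle_total (L n) S) => // SL.
  have /clt_nge := Lomega n; case; apply: cle_trans hdens _.
  exact: dens_le_separated (Linf n) Snet SL.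
pose f n := projT1 (cid (LS n)).
have fI n : injective (f n) by rewrite /f; case: cid.
pose phi m (x : L m.+1) : X := (2 * delta) *: val (f _ x).
have dd0 : 0 < 2 * delta by rewrite mulr_gt0.
have phi_le m x : `|phi m x| <= 2 * delta.
  rewrite normrZ gtr0_norm // ler_piMr ?(ltW dd0) //.
  exact/SB/(set_mem (valP (f _ x))).
have phi_sep m x y : x <> y -> delta <= `|phi m x - phi m y|.
  move=> xy; rewrite -scalerBr normrZ gtr0_norm //.
  have := Ssep _ _ (set_mem (valP (f _ x))) (set_mem (valP (f _ y))).
  by move=> /(_ (fun e => xy (fI _ _ _ (val_inj e)))); nra.
(* The bound 2 arises because opposite vertices of the box lie within 1 of the centre of one
   member. *)
apply: (@cotype_unbounded R X q delta 2 _ hq d0 _) => //.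
  by apply: lt_le_trans q2.
move=> n; have [rho rho_ge [I [A [c [Ad Aleb Asmall]]]]] := covers (n%:R * (2 * delta)).
have rho0 : 0 <= rho by apply: le_trans rho_ge; rewrite mulr_ge0 // ltW.
(* A default colour for points outside the ball of radius [rho]. *)
have [i0 _] : exists i, forall y, `|y| <= rho -> `|0 - y| < 4 * delta -> A i y.
  by apply: Aleb; rewrite normr0.
have /choice[col colP] : forall x, exists i, `|x| <= rho ->
    forall y, `|y| <= rho -> `|x - y| < 4 * delta -> A i y.
  move=> x; have [xr|xr] := pselect (`|x| <= rho); last by exists i0.
  by have [i hi] := Aleb x xr; exists i.
have colA x : `|x| <= rho -> A (col x) x.
  by move=> xr; apply: colP => //; rewrite subrr normr0 mulr_gt0.
have tsum_rho (t : tup L n) : `|tsum phi t| <= rho.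
  by apply: le_trans rho_ge; exact: tsum_le.
have [|t [u [tu tuc]]] := @exists_monochromatic_box L Linf Llt _ n
    (fun t => col (0 + tsum phi t)).
  by apply: tsum_line_small colP Asmall _ _ => //; rewrite normr0 add0r.
have [d [dge dE]] := tsum_mixB phi_sep tu.
exists d; split=> [i|e]; first exact: dge.
(* Indices from [n] on never enter the sum, so [false] is only a default. *)
pose e' i := if insub i is Some j then e j else false.
have -> : \sum_(i < n) (-1) ^+ e i *: d i = \sum_(i < n) (-1) ^+ e' i *: d i.
  by apply: eq_bigr => i _; rewrite /e' valK.
rewrite -dE; set t1 := mix _ t u; set t2 := mix _ t u.
have near k : `|c (col (tsum phi t)) - tsum phi (mix k t u)| < 1.
  by have := tuc k; rewrite !add0r => <-; apply/Ad/colA.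
have := ler_distD (c (col (tsum phi t))) (tsum phi t1) (tsum phi t2).
have := near e'; have := near (fun i => ~~ e' i); rewrite -/t1 -/t2.
by rewrite (distrC (tsum phi t1) (c _)); lra.
Qed.

Theorem theorem19 (R : realType) (X : normedModType R) (alpha : ordinal_number)
    (hcotype : nontrivial_cotype X) (hlim : limit_ordinal alpha)
    (hdens : omega_ alpha <=c dens X) :
  rpc (unit_ball X) <=c rpc [set: X] /\
  omega_ alpha <=c rpc (unit_ball X) /\
  (dens X =c omega_ alpha ->
     rpc [set: X] =c omega_ alpha /\ rpc (unit_ball X) =c omega_ alpha).
Proof.
have BX : rpc (unit_ball X) <=c rpc [set: X].
  by apply: rpc_homo => //; exists 0; rewrite /unit_ball /= normr0.
have oB := omega_le_rpc_unit_ball hcotype hlim hdens.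
split=> //; split=> // /ceqP[densle _].
have [[D [dD /ceqP[densD Ddens]]] _] := densP X.
have Xo : rpc [set: X] <=c omega_ alpha.
  apply: (rpc_le_dense (@omega_infinite alpha) dD); apply/ceqP; split.
    exact: cle_trans hdens densD.
  exact: cle_trans Ddens densle.
split; apply/ceqP; split=> //.
- exact: cle_trans oB BX.
- exact: cle_trans BX Xo.
Qed.
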